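(* Let $G$ be a finite group with a unitary representation $\rho_0$ on $\mathbb{R}^{d_0}$ (i.e. $\rho_0(g^{-1})=\rho_0(g)^\top$ for all $g\in G$), and let $S=\{(\mathbf{x}_i,y_i): i\in[n]\}$ with $\mathbf{x}_i\in\mathbb{R}^{d_0}$, $y_i\in\{\pm1\}$. Let $\boldsymbol\beta_{\mathrm{steer}}^\infty=\lim_{t\to\infty}\frac{\mathcal{P}_{\mathrm{steer}}(\mathbf{W}(t))}{\|\mathcal{P}_{\mathrm{steer}}(\mathbf{W}(t))\|}$ be the directional limit of the predictor parameterized by a linear steerable network trained by gradient flow on the original data set $S$, assuming $\mathcal{L}_{\mathcal{P}_{\mathrm{steer}}}(\mathbf{W}(t_0);S)<1$ for some $t_0>0$; let $\boldsymbol\beta_{\mathrm{fc}}^\infty=\lim_{t\to\infty}\frac{\mathcal{P}_{\mathrm{fc}}(\mathbf{W}_{\mathrm{fc}}(t))}{\|\mathcal{P}_{\mathrm{fc}}(\mathbf{W}_{\mathrm{fc}}(t))\|}$ be that of a linear fully-connected network also trained by gradient flow on the same data set $S$, assuming $\mathcal{L}_{\mathcal{P}_{\mathrm{fc}}}(\mathbf{W}_{\mathrm{fc}}(t_0');S)<1$ for some $t_0'>0$. Let $M_{\mathrm{steer}}$ and $M_{\mathrm{fc}}$ be the (signed) margins of $\boldsymbol\beta_{\mathrm{steer}}^\infty$ and $\boldsymbol\beta_{\mathrm{fc}}^\infty$ on the augmented data set $S_{\mathrm{aug}}=\{(\rho_0(g)\mathbf{x}_i,y_i): i\in[n],g\in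 G\}$, i.e. $$M_{\mathrm{steer}}:=\min_{i\in[n],g\in G}y_i\langle\boldsymbol\beta_{\mathrm{steer}}^\infty,\rho_0(g)\mathbf{x}_i\rangle,\qquad M_{\mathrm{fc}}:=\min_{i\in[n],g\in G}y_i\langle\boldsymbol\beta_{\mathrm{fc}}^\infty,\rho_0(g)\mathbf{x}_i\rangle.$$ Then $M_{\mathrm{steer}}\ge M_{\mathrm{fc}}$.
   Context: Notation. $[n]=\{1,\dots,n\}$; $\langle\cdot,\cdot\rangle$ and $\|\cdot\|$ are the Euclidean inner product and norm. $G$ is a finite group and $\rho_0:G\to GL(\mathbb{R}^{d_0})$ a representation. Linear steerable network. Let $L\ge2$. Given finite-dimensional real representations $(\mathcal{X}_l,\rho_l)$ of $G$, $l=0,\dots,L$, with $(\mathcal{X}_0,\rho_0)=(\mathbb{R}^{d_0},\rho_0)$, $(\mathcal{X}_L,\rho_L)=(\mathbb{R},\text{trivial})$, and $(\mathcal{X}_1,\rho_1)$ the regular representation $\mathcal{X}_1=\{\mathbf{x}_1:G\to\mathbb{R}^{d_1}\}$, $(\rho_1(g)\mathbf{x}_1)(h)=\mathbf{x}_1(g^{-1}h)$; the representations $(\mathcal{X}_l,\rho_l)$ for $2\le l\le L-1$ are arbitrary. The first layer is the $G$-lifting map $\Psi_1(\mathbf{x};\mathbf{w}_1)(g)=\mathbf{w}_1^\top\rho_0(g)^{-1}\mathbf{x}\in\mathbb{R}^{d_1}$ with trainable $\mathbf{w}_1\in\mathbb{R}^{d_0\times d_1}$. For $2\le l\le L$, one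 fixes a finite collection of $G$-equivariant linear maps (intertwiners) $\psi_l^1,\dots,\psi_l^{N_l}:\mathcal{X}_{l-1}\to\mathcal{X}_l$ (not necessarily a basis of all intertwiners) and sets $\Psi_l(\mathbf{x};\mathbf{w}_l)=\sum_{j=1}^{N_l}w_l^j\psi_l^j(\mathbf{x})$ with trainable $\mathbf{w}_l\in\mathbb{R}^{N_l}$. The network is $f_{\mathrm{steer}}(\mathbf{x};\mathbf{W})=\Psi_L(\cdots\Psi_2(\Psi_1(\mathbf{x};\mathbf{w}_1);\mathbf{w}_2)\cdots;\mathbf{w}_L)$, with $\mathbf{W}=(\mathbf{w}_1,\dots,\mathbf{w}_L)\in\mathcal{W}_{\mathrm{steer}}=\mathbb{R}^{d_0\times d_1}\times\prod_{l=2}^L\mathbb{R}^{N_l}$. For each $\mathbf{W}$ it is linear in $\mathbf{x}$, and $\mathcal{P}_{\mathrm{steer}}(\mathbf{W})\in\mathbb{R}^{d_0}$ denotes the vector with $f_{\mathrm{steer}}(\mathbf{x};\mathbf{W})=\langle\mathbf{x},\mathcal{P}_{\mathrm{steer}}(\mathbf{W})\rangle$ for all $\mathbf{x}$. Linear fully-connected network. With widths $k_0=d_0,k_1,\dots,k_{L-1}\ge1$ and parameters $\mathbf{W}=(\mathbf{w}_1,\dots,\mathbf{w}_L)\in\left(\prod_{l=1}^{L-1}\mathbb{R}^{k_{l-1}\times k_l}\right)\times\mathbb{R}^{k_{L-1}}$, it is $f_{\mathrm{fc}}(\mathbf{x};\mathbf{W})=\langle\mathbf{x},\mathcal{P}_{\mathrm{fc}}(\mathbf{W})\rangle$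 with $\mathcal{P}_{\mathrm{fc}}(\mathbf{W})=\mathbf{w}_1\mathbf{w}_2\cdots\mathbf{w}_L\in\mathbb{R}^{d_0}$. Gradient flow. For $\mathcal{P}\in\{\mathcal{P}_{\mathrm{steer}},\mathcal{P}_{\mathrm{fc}}\}$, let $\mathcal{L}_{\mathcal{P}}(\mathbf{W};S)=\sum_{i=1}^n\exp(-y_i\langle\mathbf{x}_i,\mathcal{P}(\mathbf{W})\rangle)$. Training by gradient flow on $S$ from an initialization $\mathbf{W}(0)$ means following the solution $\{\mathbf{W}(t)\}_{t\ge0}$ of $\frac{d\mathbf{W}}{dt}=-\nabla_{\mathbf{W}}\mathcal{L}_{\mathcal{P}}(\mathbf{W};S)$. Under the assumption that the loss is below $1$ at some positive time, the directional limits in the statement exist. *)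

(* Defs.v *)
From HB Require Import structures.
From mathcomp Require Import all_boot all_order all_algebra all_fingroup.
From mathcomp Require Import mxrepresentation.
From mathcomp Require Import all_classical all_reals all_analysis.
Set Implicit Arguments.
Unset Strict Implicit.
Unset Printing Implicit Defensive.
Import Order.TTheory GRing.Theory Num.Theory.
Import numFieldNormedType.Exports.
Local Open Scope classical_set_scope.
Local Open Scope ring_scope.

Section Euclidean.
Variables (R : realType) (d : nat).

Definition dot (u v : 'cV[R]_d) : R := \sum_i u i ord0 * v i ord0.

(* Euclidean norm: the library norm on matrices is the sup norm. *)
Definition enorm (u : 'cV[R]_d) : R := Num.sqrt (dot u u).

Definition directional_limit (beta : R -> 'cV[R]_d) (b : 'cV[R]_d) : Prop :=
  (enorm (beta t))^-1 *: beta t @[t --> +oo] --> b.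

End Euclidean.

(* A parameter vector is a function from a finite type of coordinates to R. *)
Section GradientFlow.
Variables (R : realType) (I : finType).

Definition partial_derivative (F : (I -> R) -> R) (W : I -> R) (c : I) : R :=
  derive1 (fun s : R => F (dfwith W c s)) (W c).

(* At t = 0 only right continuity of the solution is required. *)
Definition gradient_flow (F : (I -> R) -> R) (W : R -> I -> R) : Prop :=
  (forall c : I, {within `[0, +oo[, continuous (fun t : R => W t c)}) /\
  (forall (t : R) (c : I), 0 < t ->
     is_derive t 1 (fun s : R => W s c) (- partial_derivative F (W t) c)).

End GradientFlow.

Section Data.
Variables (R : realType) (d n : nat).
Variables (x : 'I_n -> 'cV[R]_d) (y : 'I_n -> R).

Definition exp_loss (I : Type) (P : (I -> R) -> 'cV[R]_d) (W : I -> R) : R :=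
  \sum_i expR (- y i * dot (x i) (P W)).

End Data.

Section AugmentedMargin.
Variables (R : realType) (gT : finGroupType) (d n : nat).
Variable rho : mx_representation R [set: gT]%G d.
Variables (x : 'I_n.+1 -> 'cV[R]_d) (y : 'I_n.+1 -> R).

(* The default value of the iterated minimum is itself one of its terms. *)
Definition augmented_margin (b : 'cV[R]_d) : R :=
  let m (p : 'I_n.+1 * gT) : R := y p.1 * dot b (rho p.2 *m x p.1) in
  \big[Num.min/m (ord0, 1%g)]_p m p.

End AugmentedMargin.

Section Representations.
Variables (R : realType) (gT : finGroupType).

Record real_rep := RealRep {
  rep_space :> vectType R;
  rep_act : gT -> 'End(rep_space);
  rep_act1 : rep_act 1%g = \1%VF;
  rep_actM : forall g h : gT,
    rep_act (g * h)%g = (rep_act g \o rep_act h)%VF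
}.

Definition equivariant (U V : real_rep) (psi : 'Hom(U, V)) : Prop :=
  forall (g : gT) (u : U), psi (rep_act U g u) = rep_act V g (psi u).

Lemma trivial_actM (g h : gT) : \1%VF = (\1 \o \1)%VF :> 'End(R^o).
Proof. by rewrite comp_lfun1l. Qed.

Definition trivial_rep : real_rep :=
  @RealRep R^o (fun _ : gT => \1%VF) erefl trivial_actM.

Section Regular.
Variable d1 : nat.

Definition translate (g : gT) (f : {ffun gT -> 'cV[R]_d1}) :
    {ffun gT -> 'cV[R]_d1} :=
  [ffun h => f (g^-1 * h)%g].

Lemma translate_is_linear (g : gT) : linear (translate g).
Proof. by move=> a u v; apply/ffunP => h; rewrite !ffunE. Qed.

HB.instance Definition _ (g : gT) :=
  GRing.isLinear.Build R {ffun gT -> 'cV[R]_d1} {ffun gT -> 'cV[R]_d1} _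
    (translate g) (translate_is_linear g).

Lemma translate1 : linfun (translate 1%g) = \1%VF.
Proof.
by apply/lfunP => u; rewrite !lfunE /=; apply/ffunP => h;
  rewrite !ffunE invg1 mul1g.
Qed.

Lemma translateM (g h : gT) :
  linfun (translate (g * h)%g)
    = (linfun (translate g) \o linfun (translate h))%VF.
Proof.
by apply/lfunP => u; rewrite comp_lfunE !lfunE /=; apply/ffunP => k;
  rewrite !ffunE invMg mulgA.
Qed.

Definition regular_rep : real_rep :=
  @RealRep {ffun gT -> 'cV[R]_d1} (fun g => linfun (translate g))
    translate1 translateM.

End Regular.

(* [steerable_layers U k] is a stack of k linear steerable layers from U to the
   trivial representation on R, i.e. layers 2, ..., k.+1 of a network of depth
   k.+1 when U is the regular representation X_1.  Each layer carries its own
   number N of fixed intertwiners psi and, except for the last one, its own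
   output representation V. *)
Inductive steerable_layers (U : real_rep) : nat -> Type :=
| SteerableLast (N : nat) (psi : 'I_N -> 'Hom(U, trivial_rep))
    (psi_equiv : forall j : 'I_N, equivariant (psi j)) :
    steerable_layers U 1
| SteerableCons (V : real_rep) (N : nat) (psi : 'I_N -> 'Hom(U, V))
    (psi_equiv : forall j : 'I_N, equivariant (psi j))
    (k : nat) (net : steerable_layers V k) :
    steerable_layers U k.+1.

Fixpoint layers_param (U : real_rep) (k : nat) (net : steerable_layers U k) :
    finType :=
  match net with
  | @SteerableLast _ N _ _ => 'I_N
  | @SteerableCons _ _ N _ _ _ net' => ('I_N + layers_param net')%type
  end.

Fixpoint layers_eval (U : real_rep) (k : nat) (net : steerable_layers U k) :
    (layers_param net -> R) -> U -> R :=
  match net return (layers_param net -> R) -> U -> R with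
  | @SteerableLast _ N psi _ => fun w u => (\sum_j w j *: psi j) u
  | @SteerableCons _ _ N psi _ _ net' => fun w u =>
      layers_eval (fun c => w (inr c)) ((\sum_j w (inl j) *: psi j) u)
  end.

End Representations.

Section SteerableNetwork.
Variables (R : realType) (gT : finGroupType) (d0 d1 k : nat).
Variable rho : mx_representation R [set: gT]%G d0.
Variable net : steerable_layers (regular_rep R gT d1) k.

Definition lifting (w : 'M[R]_(d0, d1)) (u : 'cV[R]_d0) :
    regular_rep R gT d1 :=
  [ffun g => w^T *m (invmx (rho g) *m u)].

Definition steer_param : finType :=
  ('I_d0 * 'I_d1 + layers_param net)%type.

Definition steer_eval (W : steer_param -> R) (u : 'cV[R]_d0) : R :=
  layers_eval (fun c => W (inr c))
    (lifting (\matrix_(i, j) W (inl (i, j))) u).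

Definition steer_predictor (W : steer_param -> R) : 'cV[R]_d0 :=
  \col_i steer_eval W (delta_mx i ord0).

End SteerableNetwork.

Arguments steer_eval {R gT d0 d1 k} rho net W u.
Arguments steer_predictor {R gT d0 d1 k} rho net W.

Lemma layers_eval_linear (R : realType) (gT : finGroupType) (U : real_rep R gT)
    (k : nat) (net : steerable_layers U k) (w : layers_param net -> R)
    (a : R) (u v : U) :
  layers_eval w (a *: u + v) = a * layers_eval w u + layers_eval w v.
Proof.
by elim: net w u v => [{}U N psi psiE|{}U V N psi psiE {}k net IH] w u v /=;
  rewrite linearP ?IH.
Qed.

Lemma steer_eval_linear (R : realType) (gT : finGroupType) (d0 d1 k : nat)
    (rho : mx_representation R [set: gT]%G d0)
    (net : steerable_layers (regular_rep R gT d1) k)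
    (W : steer_param d0 net -> R) (a : R) (u v : 'cV[R]_d0) :
  steer_eval rho net W (a *: u + v) = a * steer_eval rho net W u + steer_eval rho net W v.
Proof.
rewrite /steer_eval -layers_eval_linear; congr layers_eval.
by apply/ffunP => g; rewrite !ffunE !(mulmxDr, scalemxAr).
Qed.

(* The predictor is the unique vector representing the linear map steer_eval. *)
Lemma steer_predictorP (R : realType) (gT : finGroupType) (d0 d1 k : nat)
    (rho : mx_representation R [set: gT]%G d0)
    (net : steerable_layers (regular_rep R gT d1) k)
    (W : steer_param d0 net -> R) (b : 'cV[R]_d0) :
  (forall u : 'cV[R]_d0, steer_eval rho net W u = dot u b)
    <-> b = steer_predictor rho net W.
Proof.
have dotE (i : 'I_d0) (c : 'cV[R]_d0) : dot (delta_mx i ord0) c = c i ord0.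
  rewrite /dot (bigD1 i) //= mxE !eqxx mul1r big1 ?addr0 // => j /negPf ji.
  by rewrite mxE ji mul0r.
split=> [Wb | -> u].
  by apply/colP => i; rewrite mxE Wb dotE.
have f0 : steer_eval rho net W 0 = 0.
  have := steer_eval_linear rho W (-1) 0 0.
  by rewrite scaler0 addr0 mulN1r addNr.
rewrite {1}[u]matrix_sum_delta /dot.
under eq_bigr do rewrite big_ord1.
elim/big_rec2: _ => // i s v _ IH.
by rewrite steer_eval_linear IH !mxE.
Qed.

(* The input width is k = k_0 and ks = [:: k_1; ...; k_(L-1)], so that the last
   layer is a vector of size k_(L-1). *)
Section FullyConnected.
Variable R : realType.

Fixpoint fc_param (k : nat) (ks : seq nat) : finType :=
  match ks with
  | [::] => 'I_k
  | k' :: ks' => ('I_k * 'I_k' + fc_param k' ks')%type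
  end.

Fixpoint fc_predictor (k : nat) (ks : seq nat) :
    (fc_param k ks -> R) -> 'cV[R]_k :=
  match ks return (fc_param k ks -> R) -> 'cV[R]_k with
  | [::] => fun W => \col_i W i
  | k' :: ks' => fun W =>
      (\matrix_(i < k, j < k') W (inl (i, j)))
        *m fc_predictor (fun c => W (inr c))
  end.

End FullyConnected.

Arguments fc_predictor {R} k ks W.

(* Main.v *)
(* The fully-connected limit enters only through its norm, which is at most 1:
   the steerable limit has the largest margin on the augmented data among all
   vectors of the unit ball.

   By equivariance the predictor is [P(W) = Q w_1 c], where [Q] is the sum of the
   matrices [rho(g)] and [c] depends only on the deeper layers, so it is
   homogeneous in [W] of degree [D = L].  Let [p_i = y_i <x_i, P(W)>], let [F] be
   the loss and [nu = sum_i exp(-p_i) p_i].  As in Lyu and Li, the derivative of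
   [ln(-ln F) - D (1 + eps) ln |W|] is nonnegative as long as
   [|grad F|^2 |W|^2 >= (1 + eps) (D nu)^2].  For [eps = 0] this is Cauchy-Schwarz,
   and yields that [-ln F] is bounded below by a multiple of [|W|^D].  For
   [eps > 0] it cannot hold for all large times, since [-ln F <= p_i] is bounded
   above by a multiple of [|W|^D] and [|W|] is unbounded.  So [W] is almost
   parallel to [- grad F] at arbitrarily large times.

   The [w_1]-block of [- grad F] is [q c^T] with
   [q = sum_i exp(-p_i) y_i Q x_i]; hence, at those times, [P] is almost parallel
   to [q].  Pairing [q] with a competitor [u] of norm at most 1 and margin [M]
   gives at least [|G| F M], while pairing it with [P] gives
   [|G| nu <= |G| F (p_j + N)] for every [j], with [N] the number of data points.
   As [|P|] tends to infinity, [M] is at most the limit of [p_j / |P|]. *)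
Require Import Defs.
From HB Require Import structures.
From mathcomp Require Import all_boot all_order all_algebra all_fingroup.
From mathcomp Require Import mxrepresentation.
From mathcomp Require Import all_classical all_reals all_analysis.
From mathcomp Require Import ring lra.
Set Implicit Arguments.
Unset Strict Implicit.
Unset Printing Implicit Defensive.
Import Order.TTheory GRing.Theory Num.Theory.
Import numFieldNormedType.Exports.
Local Open Scope classical_set_scope.
Local Open Scope ring_scope.

(** * One-variable calculus *)

Lemma nondecreasing_of_derive_ge0 (R : realType) (f df : R -> R) (a b : R) :
  a <= b -> (forall t, a <= t -> is_derive t 1 f (df t)) ->
  (forall t, a <= t -> 0 <= df t) -> f a <= f b.
Proof.
move=> ab fdf df_ge0.
have [||c] := @MVT_segment R f df a b ab.
- by move=> t /[!in_itv]/= /andP[/ltW/fdf].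
- apply: derivable_within_continuous => t /[!in_itv]/= /andP[/fdf tf _].
  exact: ex_derive.
- rewrite in_itv /= => /andP[ac _] fE.
  by rewrite -subr_ge0 fE mulr_ge0 ?df_ge0// subr_ge0.
Qed.

Lemma is_derive_affine (R : realType) (a b t : R) :
  is_derive t 1 (fun s => a + s * b) b.
Proof.
have -> : (fun s => a + s * b) = cst a + id * cst b by [].
apply: is_derive_eq.
by rewrite scaler0 !add0r /GRing.scale /= mulr1.
Qed.

(** * Gradients along curves, and Euler's identity *)

Section CurveGradient.
Variables (R : realType) (I : finType).
Implicit Types (F G : (I -> R) -> R) (dF dG : (I -> R) -> I -> R).

(* The chain rule along every differentiable curve is taken as the definition of
   a gradient: it is closed under the algebra needed here and bypasses Frechet
   differentiability on the function space [I -> R]. *)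
Definition curve_gradient F dF :=
  forall (w : R -> I -> R) (t : R) (v : I -> R),
    (forall c, is_derive t 1 (fun s => w s c) (v c)) ->
    is_derive t 1 (fun s => F (w s)) (\sum_c dF (w t) c * v c).

Definition has_gradient F := exists dF, curve_gradient F dF.

Lemma has_gradient_coord (c : I) : has_gradient (fun w => w c).
Proof.
exists (fun _ c' => (c' == c)%:R) => w t v wv.
apply: is_derive_eq.
by rewrite (bigD1 c) //= eqxx mul1r big1 ?addr0 // => i /negPf ->; rewrite mul0r.
Qed.

Lemma has_gradient_cst (a : R) : has_gradient (fun=> a).
Proof.
exists (fun _ _ => 0) => w t v wv; apply: is_derive_eq.
by rewrite big1 // => i _; rewrite mul0r.
Qed.

Lemma has_gradientD F G :
  has_gradient F -> has_gradient G -> has_gradient (fun w => F w + G w).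
Proof.
move=> [dF hF] [dG hG]; exists (fun w c => dF w c + dG w c) => w t v wv.
apply: is_derive_eq; first exact: (is_deriveD (hF _ _ _ wv) (hG _ _ _ wv)).
by rewrite -big_split; apply: eq_bigr => i _; rewrite mulrDl.
Qed.

Lemma has_gradientM F G :
  has_gradient F -> has_gradient G -> has_gradient (fun w => F w * G w).
Proof.
move=> [dF hF] [dG hG]; exists (fun w c => F w * dG w c + G w * dF w c) => w t v wv.
apply: is_derive_eq; first exact: (is_deriveM (hF _ _ _ wv) (hG _ _ _ wv)).
rewrite !scaler_sumr -big_split; apply: eq_bigr => i _.
by rewrite mulrDl -!mulrA.
Qed.

Lemma has_gradient_sum (J : Type) (r : seq J) (F : J -> (I -> R) -> R) :
  (forall j, has_gradient (F j)) -> has_gradient (fun w => \sum_(j <- r) F j w).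
Proof.
move=> hF; elim: r => [|j r IH].
  by under eq_fun do rewrite big_nil; exact: has_gradient_cst.
by under eq_fun do rewrite big_cons; exact: has_gradientD.
Qed.

(** The chain rule is applied to the curve that moves only coordinate [c]. This links an abstract
    gradient to the partial derivatives that drive [gradient_flow]. *)
Lemma curve_gradient_partial F dF (W : I -> R) (c : I) :
  curve_gradient F dF -> partial_derivative F W c = dF W c.
Proof.
move=> hF; rewrite /partial_derivative derive1E.
have WE : dfwith W c (W c) = W by apply/funext => i; case: mathcomp_extra.dfwithP.
have /hF D : forall i,
    is_derive (W c) 1 (fun s => dfwith W c s i) ((i == c)%:R).
  move=> i; have [->|ic] := eqVneq i c.
    by under eq_fun do rewrite mathcomp_extra.dfwithin; exact: is_derive_id.
  by under eq_fun do rewrite mathcomp_extra.dfwithout 1?eq_sym//; exact: is_derive_cst.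
rewrite derive_val WE (bigD1 c) //= eqxx mulr1 big1 ?addr0 // => i /negPf ->.
by rewrite mulr0.
Qed.

Lemma curve_gradient_line F dF (W V : I -> R) :
  curve_gradient F dF ->
  is_derive (0 : R) 1 (fun s => F (fun c => W c + s * V c)) (\sum_c dF W c * V c).
Proof.
move=> hF.
have /hF : forall c, is_derive (0 : R) 1 (fun s => W c + s * V c) (V c).
  by move=> c; exact: is_derive_affine.
by congr is_derive; apply: eq_bigr => c _; congr (dF _ _ * _); apply/funext => i;
  rewrite mul0r addr0.
Qed.

(** Both sides are the derivative at [s = 0] of [F] on the ray [(1 + s) W]: one by the chain rule,
    the other by homogeneity. *)
Lemma euler_identity F dF (D : nat) (W : I -> R) :
  curve_gradient F dF ->
  (forall (s : R) w, F (fun c => s * w c) = s ^+ D * F w) ->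
  \sum_c dF W c * W c = D%:R * F W.
Proof.
move=> hF homog.
have D1 := @curve_gradient_line F dF W W hF.
have FE : (fun s : R => F (fun c => W c + s * W c))
    = (fun s : R => (1 + s * 1) ^+ D * F W).
  apply/funext => s; rewrite -homog; congr F; apply/funext => c.
  by rewrite mulr1 mulrDl mul1r.
rewrite FE in D1; have <- := @derive_val _ _ _ _ _ _ _ D1.
have D2 : is_derive (0 : R) 1 (fun s : R => (1 + s * 1) ^+ D * F W) (D%:R * F W).
  have -> : (fun s : R => (1 + s * 1) ^+ D * F W)
      = (fun s : R => 1 + s * 1) ^+ D * cst (F W) by rewrite exprfctE.
  have ? := is_derive_affine (1 : R) 1 0.
  apply: is_derive_eq.
  by rewrite scaler0 add0r mul0r addr0 expr1n /GRing.scale /= !mulr1 mulrC.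
exact: derive_val.
Qed.

End CurveGradient.

(** Lets a function of the deeper weights count as a function of all weights; the derivative at [i]
    collects the fibre of [f] over [i]. *)
Lemma has_gradient_reindex (R : realType) (I J : finType) (f : J -> I)
    (F : (J -> R) -> R) :
  has_gradient F -> has_gradient (fun w : I -> R => F (fun c => w (f c))).
Proof.
move=> [dF hF].
exists (fun w i => \sum_(c | f c == i) dF (fun c => w (f c)) c) => w t v wv.
apply: is_derive_eq; first by apply: (hF (fun s c => w s (f c))) => c; exact: wv.
rewrite (partition_big f predT) //=; apply: eq_bigr => i _.
by rewrite mulr_suml; apply: eq_bigr => c /eqP ->.
Qed.

(** * Logarithmic derivatives, sums and the Cauchy-Schwarz inequality *)

Lemma is_derive_ln_comp (R : realType) (f : R -> R) (df t : R) :
  is_derive t 1 f df -> 0 < f t -> is_derive t 1 (fun s => ln (f s)) (df / f t).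
Proof.
move=> fdf ft_gt0; have lnft := is_derive1_ln ft_gt0.
by apply: is_derive_eq (is_derive1_comp lnft fdf) _; rewrite mulrC.
Qed.

Lemma is_derive_bigsum (R : realType) (I : finType) (f : I -> R -> R) (df : I -> R)
    (t : R) :
  (forall i, is_derive t 1 (f i) (df i)) ->
  is_derive t 1 (fun s => \sum_i f i s) (\sum_i df i).
Proof.
move=> fdf; have -> : (fun s => \sum_i f i s) = \sum_i f i.
  by apply/funext => s; rewrite fct_sumE.
by elim/big_ind2 : _ => // *; [exact: is_derive_cst|exact: is_deriveD].
Qed.

Lemma sum_sqr_lin (R : realType) (I : finType) (a b : I -> R) (k l : R) :
  \sum_c (k * a c - l * b c) ^+ 2
    = k ^+ 2 * \sum_c a c ^+ 2 - 2 * (k * l) * (\sum_c a c * b c)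
      + l ^+ 2 * \sum_c b c ^+ 2.
Proof.
rewrite !mulr_sumr -sumrB -big_split /=; apply: eq_bigr => c _; ring.
Qed.

Lemma cauchy_schwarz (R : realType) (I : finType) (a b : I -> R) :
  (\sum_c a c * b c) ^+ 2 <= (\sum_c a c ^+ 2) * \sum_c b c ^+ 2.
Proof.
have A0 : 0 <= \sum_c a c ^+ 2 by apply: sumr_ge0 => c _; exact: sqr_ge0.
move: A0; rewrite le_eqVlt => /predU1P[A0|A0].
  have a0 c : a c = 0.
    apply/eqP; rewrite -sqrf_eq0; apply/eqP.
    by apply: (psumr_eq0P _ (esym A0)) => // i _; exact: sqr_ge0.
  by rewrite -A0 mul0r big1 ?expr0n// => c _; rewrite a0 mul0r.
(* With [X = <a, b>] and [A = |a|^2], this sum equals [A (A |b|^2 - X^2)], and [A] is positive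
   here. *)
have : 0 <= \sum_c ((\sum_i a i * b i) * a c - (\sum_i a i ^+ 2) * b c) ^+ 2.
  by apply: sumr_ge0 => c _; exact: sqr_ge0.
rewrite sum_sqr_lin.
set A := \sum_c a c ^+ 2 in A0 *; set B := \sum_c b c ^+ 2.
set X := \sum_c a c * b c => H.
rewrite -subr_ge0 -(pmulr_rge0 _ A0); move: H; congr (0 <= _); ring.
Qed.

(** * Gradient flow on the exponential loss of homogeneous margins *)

Section HomogeneousFlow.
Variables (R : realType) (I : finType) (n D : nat).
Variables (p : 'I_n.+1 -> (I -> R) -> R) (dp : 'I_n.+1 -> (I -> R) -> I -> R).
Hypothesis p_grad : forall i, curve_gradient (p i) (dp i).
Hypothesis D_gt0 : (0 < D)%N.
Hypothesis p_homog : forall i s w, p i (fun c => s * w c) = s ^+ D * p i w.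
Variable K : R.
Hypothesis p_le : forall i w (r : R), 0 <= r -> (forall c, `|w c| <= r) -> p i w <= K * r ^+ D.

Definition margin_loss (w : I -> R) : R := \sum_i expR (- p i w).
Definition mean_margin (w : I -> R) : R := \sum_i expR (- p i w) * p i w.
(** The negative gradient of [margin_loss], hence the velocity of the flow. *)
Definition descent (w : I -> R) (c : I) : R := \sum_i expR (- p i w) * dp i w c.
Definition sqnorm (w : I -> R) : R := \sum_c w c ^+ 2.

Local Notation F := margin_loss.
Local Notation nu := mean_margin.
Local Notation g := descent.
Local Notation S := sqnorm.

Lemma margin_loss_gradient : curve_gradient F (fun w c => - g w c).
Proof.
move=> w t v wv.
have D1 i : is_derive t 1 (expR \o (fun s => - p i (w s)))
    (expR (- p i (w t)) * - (\sum_c dp i (w t) c * v c)).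
  apply: is_derive1_comp; apply: (@is_deriveN _ _ _ (fun s => p i (w s))).
  exact: p_grad.
apply: is_derive_eq; first exact: is_derive_bigsum D1.
under [RHS]eq_bigr do rewrite mulNr mulr_suml.
rewrite sumrN exchange_big /= -sumrN; apply: eq_bigr => i _.
rewrite mulrN mulr_sumr; congr (- _); apply: eq_bigr => c _.
by rewrite mulrA.
Qed.

Lemma sqnorm_gradient : curve_gradient S (fun w c => 2 * w c).
Proof.
move=> w t v wv.
apply: is_derive_bigsum => c.
have -> : (fun s => w s c ^+ 2) = w^~ c * w^~ c by apply/funext => s; rewrite expr2.
have ? := wv c; apply: is_derive_eq.
by rewrite /GRing.scale/=; ring.
Qed.

(** Euler's identity for each [p i], weighted by [expR (- p i w)]. It controls both the growth of
    [|W|^2] and the angle between [W] and its velocity. *)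
Lemma descent_euler w : \sum_c w c * g w c = D%:R * nu w.
Proof.
rewrite /descent /mean_margin; under eq_bigr do rewrite mulr_sumr.
rewrite exchange_big mulr_sumr; apply: eq_bigr => i _ /=.
rewrite mulrCA -(euler_identity w (@p_grad i) (p_homog i)) mulr_sumr.
by apply: eq_bigr => c _; ring.
Qed.

Lemma expR_margin_le i w : expR (- p i w) <= F w.
Proof. by rewrite /margin_loss (bigD1 i) //= lerDl sumr_ge0// => *; exact: expR_ge0. Qed.

Lemma margin_loss_gt0 w : 0 < F w.
Proof. exact: lt_le_trans (expR_gt0 _) (expR_margin_le ord0 w). Qed.

Lemma margin_ge i w : - ln (F w) <= p i w.
Proof.
rewrite lerNl -ler_expR lnK ?posrE ?margin_loss_gt0 //; exact: expR_margin_le.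
Qed.

Lemma mean_margin_ge w : F w * - ln (F w) <= nu w.
Proof.
rewrite {1}/margin_loss mulr_suml; apply: ler_sum => i _.
by rewrite ler_wpM2l ?expR_ge0// margin_ge.
Qed.

(* [x * exp (- x) <= 1] with [x] the gap between the two margins. *)
Lemma mean_margin_le j w : nu w <= F w * (p j w + n.+1%:R).
Proof.
have H i : expR (- p i w) * p i w <= expR (- p i w) * p j w + F w.
  rewrite -lerBlDl -mulrBr.
  apply: le_trans (expR_margin_le j w).
  have -> : - p i w = - p j w + - (p i w - p j w) by ring.
  rewrite expRD -mulrA ger_pMr ?expR_gt0//.
  rewrite -(expRxMexpNx_1 (p i w - p j w)) mulrC ler_wpM2r ?expR_ge0//.
  by apply: le_trans (expR_ge1Dx _); rewrite lerDr.
apply: le_trans (ler_sum _ (fun i _ => H i)) _.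
by rewrite big_split /= -mulr_suml sumr_const card_ord mulrDr -[F w *+ _]mulr_natr.
Qed.

Variables (W : R -> I -> R) (t0 : R).
Hypothesis flow : gradient_flow F W.
Hypothesis t0_gt0 : 0 < t0.
Hypothesis loss_lt1 : F (W t0) < 1.

Lemma flow_derive t c : t0 <= t -> is_derive t 1 (W^~ c) (g (W t) c).
Proof.
move=> t0t; apply: is_derive_eq; first exact: (flow.2 t c (lt_le_trans t0_gt0 t0t)).
by rewrite (curve_gradient_partial _ _ margin_loss_gradient) opprK.
Qed.

Lemma loss_derive t : t0 <= t ->
  is_derive t 1 (fun s => F (W s)) (- \sum_c g (W t) c ^+ 2).
Proof.
move=> t0t; apply: is_derive_eq.
  exact: (margin_loss_gradient (fun c => flow_derive c t0t)).
by rewrite -sumrN; apply: eq_bigr => c _; rewrite mulNr expr2.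
Qed.

Lemma sqnorm_derive t : t0 <= t ->
  is_derive t 1 (fun s => S (W s)) (2 * (D%:R * nu (W t))).
Proof.
move=> t0t; apply: is_derive_eq.
  exact: (sqnorm_gradient (fun c => flow_derive c t0t)).
by rewrite -descent_euler mulr_sumr; apply: eq_bigr => c _; rewrite mulrA.
Qed.

Lemma loss_nonincreasing s t : t0 <= s -> s <= t -> F (W t) <= F (W s).
Proof.
move=> t0s st; rewrite -lerN2.
apply: (@nondecreasing_of_derive_ge0 _ (fun u => - F (W u))
  (fun u => \sum_c g (W u) c ^+ 2)) => // u su.
  apply: is_derive_eq; last exact: opprK.
  exact: (is_deriveN (loss_derive (le_trans t0s su))).
by apply: sumr_ge0 => c _; exact: sqr_ge0.
Qed.

Lemma loss_lt1_at t : t0 <= t -> F (W t) < 1.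
Proof. by move/(loss_nonincreasing (lexx _))/le_lt_trans; apply. Qed.

Lemma ln_loss_lt0 t : t0 <= t -> 0 < - ln (F (W t)).
Proof.
by move=> t0t; rewrite oppr_gt0 ln_lt0// margin_loss_gt0 loss_lt1_at.
Qed.

Lemma margin_gt0 i t : t0 <= t -> 0 < p i (W t).
Proof. by move=> t0t; apply: lt_le_trans (margin_ge i _); exact: ln_loss_lt0. Qed.

Lemma mean_margin_gt0 t : t0 <= t -> 0 < nu (W t).
Proof.
move=> t0t; apply: lt_le_trans (mean_margin_ge _).
by rewrite mulr_gt0 ?margin_loss_gt0 ?ln_loss_lt0.
Qed.

Lemma coord_le_norm (w : I -> R) c : `|w c| <= Num.sqrt (S w).
Proof.
rewrite -(sqrtr_sqr (w c)) ler_wsqrtr // /sqnorm (bigD1 c) //= lerDl.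
by apply: sumr_ge0 => i _; exact: sqr_ge0.
Qed.

Lemma sqnorm_ge0 w : 0 <= S w.
Proof. by apply: sumr_ge0 => c _; exact: sqr_ge0. Qed.

(** At [W t = 0] the growth bound with [r = 0] and [D > 0] would force a nonpositive margin. *)
Lemma sqnorm_gt0 t : t0 <= t -> 0 < S (W t).
Proof.
move=> t0t; have := sqnorm_ge0 (W t); rewrite le_eqVlt => /predU1P[S0|//].
have := p_le ord0 (sqrtr_ge0 _) (coord_le_norm (W t)).
rewrite -S0 sqrtr0 expr0n eqn0Ngt D_gt0 mulr0 => /(lt_le_trans (margin_gt0 ord0 t0t)).
by rewrite ltxx.
Qed.

Lemma sqnorm_nondecreasing s t : t0 <= s -> s <= t -> S (W s) <= S (W t).
Proof.
move=> t0s st; apply: (@nondecreasing_of_derive_ge0 _ (fun s => S (W s))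
  (fun s => 2 * (D%:R * nu (W s)))) => // u su.
  by apply: sqnorm_derive; exact: le_trans su.
by rewrite !mulr_ge0// ltW// mean_margin_gt0//; exact: le_trans su.
Qed.

(** While [|W|^2 <= B], the margins are bounded above, so [nu] stays above some [eta > 0]. But [nu]
    bounds the slope of [|W|^2] from below, so [|W|^2] must exceed [B], and by monotonicity it stays
    there. *)
Lemma sqnorm_unbounded (B T : R) : t0 <= T ->
  exists2 t, T <= t & forall s, t <= s -> B < S (W s).
Proof.
move=> t0T; apply: contrapT => H.
have SB t : T <= t -> S (W t) <= B.
  move=> Tt; rewrite leNgt; apply/negP => BS; apply: H; exists t => // s ts.
  by apply: lt_le_trans BS _; apply: sqnorm_nondecreasing => //; exact: le_trans Tt.
pose eta := expR (- (K * Num.sqrt B ^+ D)) * - ln (F (W T)).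
have eta_gt0 : 0 < eta by rewrite mulr_gt0 ?expR_gt0// ln_loss_lt0.
have nu_ge t : T <= t -> eta <= nu (W t).
  move=> Tt; have t0t := le_trans t0T Tt.
  apply: le_trans (mean_margin_ge _).
  apply: ler_pM; rewrite ?expR_ge0 ?(ltW (ln_loss_lt0 _))//.
    apply: le_trans (expR_margin_le ord0 _); rewrite ler_expR lerN2.
    apply: p_le; first exact: sqrtr_ge0.
    move=> c; apply: le_trans (coord_le_norm _ _) _.
    by rewrite ler_wsqrtr ?SB.
  by rewrite lerN2 ler_ln ?posrE ?margin_loss_gt0// loss_nonincreasing.
pose t := T + (B + 1) / eta.
have B0 : 0 <= B by apply: le_trans (SB T (lexx _)); exact: sqnorm_ge0.
have Tt : T <= t by rewrite lerDl divr_ge0// ?addr_ge0// ltW.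
have : S (W T) - 0 * eta <= S (W t) - (t - T) * eta.
  rewrite -{1}(subrr T).
  apply: (@nondecreasing_of_derive_ge0 _ (fun s => S (W s) - (s - T) * eta)
    (fun s => 2 * (D%:R * nu (W s)) - eta)) => // s Ts.
    have ? := sqnorm_derive (le_trans t0T Ts).
    have -> : (fun s => S (W s) - (s - T) * eta)
      = (fun s => S (W s)) - (fun s => - T * eta + s * eta).
      by apply/funext => u; rewrite !fctE; ring.
    have ? := is_derive_affine (- T * eta) eta s.
    exact: is_deriveB.
  rewrite subr_ge0; apply: le_trans (nu_ge _ Ts) _.
  have D1 : 1 <= D%:R :> R by rewrite ler1n.
  have := mean_margin_gt0 (le_trans t0T Ts); nra.
rewrite mul0r subr0 /t addrAC subrr add0r divfK ?gt_eqF// => Hle.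
have := SB t Tt; have := sqnorm_ge0 (W T); lra.
Qed.

Lemma smoothed_margin_nondecreasing (eps T t : R) : 0 <= eps -> t0 <= T -> T <= t ->
  (forall s, T <= s -> (1 + eps) * (D%:R * nu (W s)) ^+ 2
     <= S (W s) * \sum_c g (W s) c ^+ 2) ->
  ln (- ln (F (W T))) - D%:R * (1 + eps) / 2 * ln (S (W T))
    <= ln (- ln (F (W t))) - D%:R * (1 + eps) / 2 * ln (S (W t)).
Proof.
move=> eps0 t0T Tt H; set a := D%:R * _ / _.
pose Q s := \sum_c g (W s) c ^+ 2.
apply: (@nondecreasing_of_derive_ge0 _ (fun s => ln (- ln (F (W s))) - a * ln (S (W s)))
  (fun s => Q s / F (W s) / - ln (F (W s)) - a * (2 * (D%:R * nu (W s)) / S (W s))))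
  => // s Ts; have t0s := le_trans t0T Ts.
  have D1 := is_derive_ln_comp (loss_derive t0s) (margin_loss_gt0 _).
  have D2 : is_derive s 1 (fun s => - ln (F (W s))) (Q s / F (W s)).
    by apply: (is_derive_eq (is_deriveN D1)); rewrite mulNr opprK.
  have D3 := is_derive_ln_comp D2 (ln_loss_lt0 t0s).
  have D4 := is_derive_ln_comp (sqnorm_derive t0s) (sqnorm_gt0 t0s).
  have D5 := is_deriveZ a D4.
  exact: (is_deriveB D3 D5).
have S0 := sqnorm_gt0 t0s; have nu0 := mean_margin_gt0 t0s.
have l0 := ln_loss_lt0 t0s; have F0 := margin_loss_gt0 (W s).
have Q0 : 0 <= Q s by apply: sumr_ge0 => c _; exact: sqr_ge0.
(* As [F (- ln F) <= nu], the derivative of [ln (- ln F)] is at least [Q / nu], which by [H]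
   dominates the derivative of [a ln S]. *)
rewrite subr_ge0; apply: (@le_trans _ _ (Q s / nu (W s))); last first.
  rewrite -mulrA -invfM ler_wpM2l// lef_pV2 ?posrE ?mulr_gt0//.
  exact: mean_margin_ge.
rewrite ler_pdivlMr//.
have -> : a * (2 * (D%:R * nu (W s)) / S (W s)) * nu (W s)
    = (1 + eps) * (D%:R * nu (W s)) ^+ 2 / S (W s).
  by rewrite /a; field; rewrite gt_eqF.
by rewrite ler_pdivrMr// [leRHS]mulrC H.
Qed.

(** The case [eps = 0] of the monotonicity above, started at [t0]; the constant is the exponential
    of the initial value. *)
Lemma margin_growth : exists2 k, 0 < k &
  forall t i, t0 <= t -> k * Num.sqrt (S (W t)) ^+ D <= p i (W t).
Proof.
have S00 := sqnorm_gt0 (lexx t0).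
pose k0 := ln (- ln (F (W t0))) - D%:R * (1 + 0) / 2 * ln (S (W t0)).
exists (expR k0) => [|t i t0t]; first exact: expR_gt0.
apply: le_trans (margin_ge i _).
have S0 := sqnorm_gt0 t0t; have l0 := ln_loss_lt0 t0t.
have s0 : 0 < Num.sqrt (S (W t)) by rewrite sqrtr_gt0.
rewrite -ler_ln ?posrE ?mulr_gt0 ?expR_gt0 ?exprn_gt0//.
rewrite lnM ?posrE ?expR_gt0 ?exprn_gt0// expRK lnXn//.
have -> : ln (Num.sqrt (S (W t))) *+ D = D%:R * (1 + 0) / 2 * ln (S (W t)).
  rewrite -{2}(sqr_sqrtr (ltW S0)) lnXn// addr0 -mulr_natl -mulr_natl.
  by field.
rewrite -lerBrDr; apply: smoothed_margin_nondecreasing => // s t0s.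
by rewrite addr0 mul1r -descent_euler cauchy_schwarz.
Qed.

Lemma flow_alignment (eps T : R) : 0 < eps -> t0 <= T ->
  exists2 t, T <= t & exists2 l, 0 <= l &
    \sum_c (W t c - l * g (W t) c) ^+ 2 <= eps * S (W t).
Proof.
move=> eps0 t0T.
have [t Tt H] : exists2 t, T <= t &
    S (W t) * \sum_c g (W t) c ^+ 2 < (1 + eps) * (D%:R * nu (W t)) ^+ 2.
  apply: contrapT => H.
  have {}H t : T <= t -> (1 + eps) * (D%:R * nu (W t)) ^+ 2
     <= S (W t) * \sum_c g (W t) c ^+ 2.
    by move=> Tt; rewrite leNgt; apply/negP => Ht; apply: H; exists t.
  set c0 := ln (- ln (F (W T))) - D%:R * (1 + eps) / 2 * ln (S (W T)).
  (* Once [S = |W|^2] exceeds [B], the lower bound [c0 + D (1 + eps) / 2 * ln S] on [ln (- ln F)]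
     exceeds the upper bound [ln K + D / 2 * ln S]. *)
  pose B := expR ((ln K - c0) * 2 / (D%:R * eps)).
  have [t Tt /(_ t (lexx t)) BS] := sqnorm_unbounded B t0T.
  have t0t := le_trans t0T Tt; have S0 := sqnorm_gt0 t0t.
  have l0 := ln_loss_lt0 t0t.
  have s0 : 0 < Num.sqrt (S (W t)) by rewrite sqrtr_gt0.
  have Hup := le_trans (margin_ge ord0 _) (p_le ord0 (sqrtr_ge0 _) (coord_le_norm (W t))).
  have K0 : 0 < K by have := lt_le_trans l0 Hup; rewrite pmulr_lgt0// exprn_gt0.
  move: Hup; rewrite -ler_ln ?posrE ?mulr_gt0 ?exprn_gt0//.
  rewrite lnM ?posrE ?exprn_gt0// lnXn//.
  have -> : ln (Num.sqrt (S (W t))) *+ D = D%:R / 2 * ln (S (W t)).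
    rewrite -{2}(sqr_sqrtr (ltW S0)) lnXn// -mulr_natl -mulr_natl.
    by field.
  have := smoothed_margin_nondecreasing (ltW eps0) t0T Tt H; rewrite -/c0.
  have De : 0 < D%:R * eps by rewrite mulr_gt0// ltr0n.
  have : (ln K - c0) * 2 / (D%:R * eps) < ln (S (W t)).
    by rewrite -ltr_expR lnK.
  rewrite ltr_pdivrMr//; nra.
have t0t := le_trans t0T Tt.
exists t => //; have S0 := sqnorm_gt0 t0t; have nu0 := mean_margin_gt0 t0t.
have Dnu : 0 < D%:R * nu (W t) by rewrite mulr_gt0// ltr0n.
(* This multiple makes [W - l g] orthogonal to [W], so its squared norm is [|l g|^2 - |W|^2]. *)
exists (S (W t) / (D%:R * nu (W t))); first by rewrite divr_ge0// ltW.
set l := S (W t) / _.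
have -> : \sum_c (W t c - l * g (W t) c) ^+ 2
    = S (W t) * (S (W t) * (\sum_c g (W t) c ^+ 2) / (D%:R * nu (W t)) ^+ 2 - 1).
  under eq_bigr do rewrite -{1}[W t _]mul1r.
  rewrite sum_sqr_lin descent_euler -/(S (W t)) /l.
  by field; rewrite !gt_eqF// ltr0n.
rewrite mulrC ler_pM2r// lerBlDl ler_pdivrMr ?exprn_gt0//.
exact: ltW.
Qed.

End HomogeneousFlow.

(** * Polynomial growth bounds *)

Section Growth.
Variables (R : realType) (I : finType).
Implicit Types F G : (I -> R) -> R.

(** Bounding each coordinate, instead of a norm of [w], makes the notion stable under reindexing
    with the same constant. *)
Definition growth_at_most (k : nat) F :=
  exists2 K : R, 0 <= K &
    forall w (r : R), 0 <= r -> (forall c, `|w c| <= r) -> `|F w| <= K * r ^+ k.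

Lemma growth_coordM (k : nat) (c : I) F :
  growth_at_most k F -> growth_at_most k.+1 (fun w => w c * F w).
Proof.
move=> [K K0 hF]; exists K => // w r r0 wr.
by rewrite normrM exprS mulrCA ler_pM// hF.
Qed.

Lemma growthZ (k : nat) (a : R) F :
  growth_at_most k F -> growth_at_most k (fun w => a * F w).
Proof.
move=> [K K0 hF]; exists (`|a| * K) => [|w r r0 wr]; first by rewrite mulr_ge0.
by rewrite normrM -mulrA ler_pM// hF.
Qed.

Lemma growth_sum (k : nat) (J : Type) (s : seq J) (F : J -> (I -> R) -> R) :
  (forall j, growth_at_most k (F j)) ->
  growth_at_most k (fun w => \sum_(j <- s) F j w).
Proof.
move=> hF; elim: s => [|j s [K K0 IH]].
  by exists 0 => // w r r0 wr; rewrite big_nil normr0 mul0r.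
have [K' K'0 hj] := hF j; exists (K' + K) => [|w r r0 wr]; first exact: addr_ge0.
by rewrite big_cons mulrDl (le_trans (ler_normD _ _))// lerD ?hj ?IH.
Qed.

End Growth.

Lemma growth_reindex (R : realType) (I J : finType) (f : J -> I) (k : nat)
    (F : (J -> R) -> R) :
  growth_at_most k F -> growth_at_most k (fun w : I -> R => F (fun c => w (f c))).
Proof. by move=> [K K0 hF]; exists K => // w r r0 wr; apply: hF. Qed.

(** * The layers after the lifting map *)

Section Layers.
Variables (R : realType) (gT : finGroupType).
Implicit Types U V : real_rep R gT.

Lemma layers_eval_sum U (k : nat) (net : steerable_layers U k)
    (w : layers_param net -> R) (J : finType) (a : J -> R) (u : J -> U) :
  layers_eval w (\sum_j a j *: u j) = \sum_j a j * layers_eval w (u j).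
Proof.
have f0 : layers_eval w 0 = 0.
  have := layers_eval_linear w (-1) 0 0.
  by rewrite scaler0 addr0 mulN1r addNr.
by elim/big_rec2: _ => // j s v _ <-; rewrite layers_eval_linear.
Qed.

(** Exposes the output as a polynomial in the weights, one layer at a time, for the inductions
    below. *)
Lemma layers_eval_cons U V (N : nat) (psi : 'I_N -> 'Hom(U, V))
    (psiE : forall j, equivariant (psi j)) (k : nat) (net : steerable_layers V k)
    (w : layers_param (SteerableCons psiE net) -> R) (u : U) :
  layers_eval w u = \sum_j w (inl j) * layers_eval (fun c => w (inr c)) (psi j u).
Proof.
rewrite /= -layers_eval_sum sum_lfunE; congr layers_eval.
by apply: eq_bigr => j _; rewrite scale_lfunE.
Qed.

Lemma layers_eval_last U (N : nat) (psi : 'I_N -> 'Hom(U, trivial_rep R gT))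
    (psiE : forall j, equivariant (psi j))
    (w : layers_param (SteerableLast psiE) -> R) (u : U) :
  layers_eval w u = \sum_j w j * psi j u.
Proof. by rewrite /= sum_lfunE; apply: eq_bigr => j _; rewrite scale_lfunE. Qed.

Lemma layers_eval_gradient U (k : nat) (net : steerable_layers U k) (u : U) :
  has_gradient (fun w : layers_param net -> R => layers_eval w u).
Proof.
elim: net u => [{}U N psi psiE|{}U V N psi psiE {}k net IH] u.
  under eq_fun do rewrite layers_eval_last.
  apply: has_gradient_sum => j; apply: has_gradientM; first exact: has_gradient_coord.
  exact: has_gradient_cst.
under eq_fun do rewrite layers_eval_cons.
apply: has_gradient_sum => j; apply: has_gradientM; first exact: has_gradient_coord.
exact: (has_gradient_reindex inr (IH (psi j u))).
Qed.

Lemma layers_eval_growth U (k : nat) (net : steerable_layers U k) (u : U) :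
  growth_at_most k (fun w : layers_param net -> R => layers_eval w u).
Proof.
elim: net u => [{}U N psi psiE|{}U V N psi psiE {}k net IH] u.
  under eq_fun do rewrite layers_eval_last.
  apply: growth_sum => j; apply: growth_coordM.
  by exists `|psi j u : R| => // w r _ _; rewrite expr0 mulr1.
under eq_fun do rewrite layers_eval_cons.
apply: growth_sum => j; apply: growth_coordM.
exact: (growth_reindex inr (IH (psi j u))).
Qed.

Lemma layers_eval_homog U (k : nat) (net : steerable_layers U k) (s : R)
    (w : layers_param net -> R) (u : U) :
  layers_eval (fun c => s * w c) u = s ^+ k * layers_eval w u.
Proof.
elim: net w u => [{}U N psi psiE|{}U V N psi psiE {}k net IH] w u.
  by rewrite !layers_eval_last mulr_sumr; apply: eq_bigr => j _; rewrite -mulrA.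
rewrite !layers_eval_cons mulr_sumr; apply: eq_bigr => j _.
by rewrite IH exprS; ring.
Qed.

(** Each intertwiner passes the action on to the next layer, and on the last space it is trivial. *)
Lemma layers_eval_invariant U (k : nat) (net : steerable_layers U k)
    (w : layers_param net -> R) (g : gT) (u : U) :
  layers_eval w (rep_act U g u) = layers_eval w u.
Proof.
elim: net w u => [{}U N psi psiE|{}U V N psi psiE {}k net IH] w u.
  by rewrite !layers_eval_last; apply: eq_bigr => j _; rewrite psiE lfunE.
by rewrite !layers_eval_cons; apply: eq_bigr => j _; rewrite psiE IH.
Qed.

End Layers.

(** * The Euclidean inner product *)

Lemma dotE (R : realType) (d : nat) (u v : 'cV[R]_d) :
  dot u v = (u^T *m v) ord0 ord0.
Proof. by rewrite mxE; apply: eq_bigr => i _; rewrite mxE. Qed.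

Section Dot.
Variables (R : realType) (d : nat).
Implicit Types u v w : 'cV[R]_d.

Lemma dotC u v : dot u v = dot v u.
Proof. by apply: eq_bigr => i _; rewrite mulrC. Qed.

Lemma dotZr (a : R) u v : dot u (a *: v) = a * dot u v.
Proof. by rewrite !dotE -scalemxAr mxE. Qed.

Lemma dotBr u v w : dot u (v - w) = dot u v - dot u w.
Proof. by rewrite !dotE mulmxBr !mxE. Qed.

Lemma dot_sumr (J : finType) u (v : J -> 'cV[R]_d) :
  dot u (\sum_j v j) = \sum_j dot u (v j).
Proof. by rewrite dotE mulmx_sumr summxE; apply: eq_bigr => j _; rewrite dotE. Qed.

Lemma dot_mulmx (e : nat) u (A : 'M[R]_(d, e)) (v : 'cV[R]_e) :
  dot u (A *m v) = dot (A^T *m u) v.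
Proof. by rewrite !dotE trmx_mul trmxK mulmxA. Qed.

Lemma dot_ge0 u : 0 <= dot u u.
Proof. by apply: sumr_ge0 => i _; rewrite -expr2 sqr_ge0. Qed.

Lemma dot_cauchy_schwarz u v : dot u v ^+ 2 <= dot u u * dot v v.
Proof.
have E (z : 'cV[R]_d) : dot z z = \sum_i z i ord0 ^+ 2.
  by apply: eq_bigr => i _; rewrite expr2.
by rewrite !E; exact: cauchy_schwarz.
Qed.

Lemma enorm_sqr u : enorm u ^+ 2 = dot u u.
Proof. by rewrite sqr_sqrtr // dot_ge0. Qed.

Lemma dot_cvg (T : Type) (F : set_system T) (FF : Filter F)
    (f h : T -> 'cV[R]_d) u v :
  f t @[t --> F] --> u -> h t @[t --> F] --> v ->
  dot (f t) (h t) @[t --> F] --> dot u v.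
Proof.
move=> fu hv; rewrite /dot.
have -> : (fun t => \sum_i f t i ord0 * h t i ord0)
    = \sum_i (fun t => f t i ord0 * h t i ord0).
  by apply/funext => t; rewrite fct_sumE.
elim/big_ind2 : _ => [|A a B b Aa Bb|i _] /=; [exact: cvg_cst|exact: cvgD|].
apply: cvgM.
  exact: (cvg_comp _ _ fu (@coord_continuous R d 1 i ord0 u)).
exact: (cvg_comp _ _ hv (@coord_continuous R d 1 i ord0 v)).
Qed.

End Dot.

Lemma dot_mulmx_le (R : realType) (d e : nat) (A : 'M[R]_(d, e)) (v : 'cV[R]_e) :
  dot (A *m v) (A *m v) <= (\sum_i \sum_j A i j ^+ 2) * dot v v.
Proof.
rewrite mulr_suml; apply: ler_sum => i _; rewrite -expr2.
have -> : (A *m v) i ord0 = dot (row i A)^T v.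
  by rewrite mxE; apply: eq_bigr => j _; rewrite !mxE.
apply: le_trans (dot_cauchy_schwarz _ _) _; apply: ler_wpM2r; first exact: dot_ge0.
by apply: ler_sum => j _; rewrite !mxE expr2.
Qed.

(** * Summation over the group *)

Section Reynolds.
Variables (R : realType) (gT : finGroupType) (d : nat).
Variable rho : mx_representation R [set: gT]%G d.
Hypothesis rho_unitary : forall g : gT, rho (g^-1)%g = (rho g)^T.

(** The Reynolds operator without its factor [1 / |G|]: under unitarity, [|G|] times the orthogonal
    projection onto the invariant vectors. *)
Definition reynolds : 'M[R]_d := \sum_(h : gT) rho h.

Lemma reynolds_tr : reynolds^T = reynolds.
Proof.
rewrite /reynolds raddf_sum (reindex_inj invg_inj) /=.
by apply: eq_bigr => h _; rewrite rho_unitary trmxK.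
Qed.

Lemma rho_reynolds (g : gT) : rho g *m reynolds = reynolds.
Proof.
rewrite /reynolds mulmx_sumr [RHS](reindex_inj (mulgI g)) /=.
by apply: eq_bigr => h _; rewrite repr_mxM ?inE.
Qed.

Lemma reynolds_sqr : reynolds *m reynolds = #|gT|%:R *: reynolds.
Proof.
rewrite {1}/reynolds mulmx_suml; under eq_bigr do rewrite rho_reynolds.
by rewrite sumr_const scaler_nat.
Qed.

(** The vector [reynolds *m u] is invariant, so its margin is constant on orbits of data points. *)
Lemma dot_reynolds_rho (u v : 'cV[R]_d) (g : gT) :
  dot (reynolds *m u) (rho g *m v) = dot (reynolds *m u) v.
Proof.
by rewrite dot_mulmx -rho_unitary mulmxA rho_reynolds.
Qed.

End Reynolds.

(** * Closed form of the steerable predictor *)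

Section Predictor.
Variables (R : realType) (gT : finGroupType) (d0 d1 k : nat).
Variable rho : mx_representation R [set: gT]%G d0.
Hypothesis rho_unitary : forall g : gT, rho (g^-1)%g = (rho g)^T.
Variable net : steerable_layers (regular_rep R gT d1) k.
Implicit Type W : steer_param d0 net -> R.

Definition first_layer W : 'M[R]_(d0, d1) := \matrix_(a, j) W (inl (a, j)).

(** The standard basis of the regular representation. *)
Definition pulse (h : gT) (j : 'I_d1) : regular_rep R gT d1 :=
  [ffun h' => if h' == h then delta_mx j ord0 else 0].

Lemma pulseE (a : R) (h h' : gT) (j j' : 'I_d1) :
  (a *: pulse h j) h' j' ord0 = a * ((h' == h) && (j' == j))%:R.
Proof. by rewrite !ffunE mxE; case: eqP => _; rewrite !mxE ?andbT. Qed.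

Definition readout W : 'cV[R]_d1 :=
  \col_j layers_eval (fun c => W (inr c)) (pulse 1%g j).

(** Translation by [h] carries [pulse 1 j] to [pulse h j], and the deeper layers are invariant under
    it. *)
Lemma layers_eval_pulse W (h : gT) (j : 'I_d1) :
  layers_eval (fun c => W (inr c)) (pulse h j) = readout W j ord0.
Proof.
rewrite mxE -[RHS](layers_eval_invariant _ h); congr layers_eval.
apply/ffunP => h'; rewrite lfunE /= !ffunE.
by rewrite -eq_mulVg1 eq_sym.
Qed.

(* An invariant functional on the regular representation is determined by its
   values at the identity, so the deeper layers collapse to one vector. *)
Lemma steer_predictorE W :
  steer_predictor rho net W = reynolds rho *m (first_layer W *m readout W).
Proof.
apply/colP => i; rewrite mxE /steer_eval.
pose w1 := first_layer W.
(* Unitarity turns [rho(h)^-1] into a transpose, so the coordinate of the lifted basis vector at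
   [(h, j)] is the [(i, j)] entry of [rho(h) w_1]. *)
have -> : lifting rho (\matrix_(a, j) W (inl (a, j))) (delta_mx i ord0)
    = \sum_(q : gT * 'I_d1) (rho q.1 *m w1) i q.2 *: pulse q.1 q.2.
  apply/ffunP => h; apply/colP => j.
  rewrite sum_ffunE summxE (bigD1 (h, j)) //= pulseE !eqxx mulr1.
  rewrite [X in _ = _ + X]big1 => [|[h' j'] /=]; last first.
    rewrite pulseE xpair_eqE [h == h']eq_sym [j == j']eq_sym => /negPf ->.
    by rewrite mulr0.
  rewrite addr0 ffunE -repr_mxV ?inE// rho_unitary mulmxA -trmx_mul.
  by rewrite -colE !mxE.
rewrite layers_eval_sum /reynolds mulmx_suml summxE.
rewrite -(pair_big predT predT (fun h j =>
  (rho h *m w1) i j * layers_eval (fun c => W (inr c)) (pulse h j))) /=.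
apply: eq_bigr => h _; rewrite mulmxA mxE.
by apply: eq_bigr => j _; rewrite layers_eval_pulse.
Qed.

End Predictor.

(** * Margins of the steerable network along the flow *)

Section SteerableMargin.
Variables (R : realType) (gT : finGroupType) (d0 d1 k n : nat).
Variable rho : mx_representation R [set: gT]%G d0.
Hypothesis rho_unitary : forall g : gT, rho (g^-1)%g = (rho g)^T.
Variable net : steerable_layers (regular_rep R gT d1) k.
Variables (x : 'I_n.+1 -> 'cV[R]_d0) (y : 'I_n.+1 -> R).

Local Notation P := (steer_predictor rho net).
Local Notation Q := (reynolds rho).

Definition steer_margin (i : 'I_n.+1) (W : steer_param d0 net -> R) : R :=
  y i * dot (x i) (P W).

(** The symmetric matrix [Q] is moved onto the data, which leaves an expression bilinear in [w_1]
    and the readout. *)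
Lemma steer_marginE i W :
  steer_margin i W = \sum_a \sum_j
    (y i * (Q *m x i) a ord0) * (W (inl (a, j)) * readout W j ord0).
Proof.
rewrite /steer_margin steer_predictorE// dot_mulmx reynolds_tr// /dot mulr_sumr.
apply: eq_bigr => a _; rewrite [(first_layer W *m _) a _]mxE mulrA mulr_sumr.
by apply: eq_bigr => j _; rewrite [first_layer W _ _]mxE.
Qed.

Lemma steer_margin_gradient i : has_gradient (steer_margin i).
Proof.
rewrite (funext (steer_marginE i)).
apply: has_gradient_sum => a; apply: has_gradient_sum => j.
apply: has_gradientM; first exact: has_gradient_cst.
apply: has_gradientM; first exact: has_gradient_coord.
under eq_fun do rewrite mxE.
exact: (has_gradient_reindex inr (layers_eval_gradient _ _)).
Qed.

Lemma readout_growth j :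
  growth_at_most k (fun W : steer_param d0 net -> R => readout W j ord0).
Proof.
under eq_fun do rewrite mxE.
exact: (growth_reindex inr (layers_eval_growth _ _)).
Qed.

Lemma steer_margin_growth i : growth_at_most k.+1 (steer_margin i).
Proof.
rewrite (funext (steer_marginE i)).
apply: growth_sum => a; apply: growth_sum => j.
by apply: growthZ; apply: growth_coordM; exact: readout_growth.
Qed.

Lemma readout_homog (s : R) (W : steer_param d0 net -> R) j :
  readout (fun c => s * W c) j ord0 = s ^+ k * readout W j ord0.
Proof. by rewrite !mxE layers_eval_homog. Qed.

Lemma steer_margin_homog i (s : R) W :
  steer_margin i (fun c => s * W c) = s ^+ k.+1 * steer_margin i W.
Proof.
rewrite !steer_marginE mulr_sumr; apply: eq_bigr => a _.
rewrite mulr_sumr; apply: eq_bigr => j _.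
by rewrite readout_homog exprS; ring.
Qed.

(** The readout depends on the deeper weights alone, so the margin is affine along coordinate
    [(a, j)] of [w_1], and any gradient must return its slope. *)
Lemma steer_margin_partial i dp (W : steer_param d0 net -> R) a j :
  curve_gradient (steer_margin i) dp ->
  dp W (inl (a, j)) = y i * (Q *m x i) a ord0 * readout W j ord0.
Proof.
move=> hdp; pose V (c : steer_param d0 net) : R := (c == inl (a, j))%:R.
have := curve_gradient_line W V hdp.
have -> : \sum_c dp W c * V c = dp W (inl (a, j)).
  rewrite (bigD1 (inl (a, j))) //= /V eqxx mulr1 big1 ?addr0 // => c /negPf ->.
  by rewrite mulr0.
have -> : (fun s : R => steer_margin i (fun c => W c + s * V c))
    = (fun s => steer_margin i W
        + s * (y i * (Q *m x i) a ord0 * readout W j ord0)).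
  apply/funext => s; rewrite !steer_marginE.
  have -> : readout (fun c => W c + s * V c) = readout W.
    apply/colP => j'; rewrite !mxE; congr layers_eval; apply/funext => c.
    by rewrite /V mulr0 addr0.
  transitivity (\sum_a' \sum_j'
      (y i * (Q *m x i) a' ord0 * (W (inl (a', j')) * readout W j' ord0)
      + s * ((y i * (Q *m x i) a' ord0 * readout W j' ord0)
             * ((a' == a) && (j' == j))%:R))).
    apply: eq_bigr => a' _; apply: eq_bigr => j' _; rewrite /V.
    have -> : (inl (a', j') == inl (a, j) :> steer_param d0 net)
        = (a' == a) && (j' == j) by [].
    ring.
  under eq_bigr do rewrite big_split /=.
  rewrite big_split /=; congr (_ + _).
  rewrite (bigD1 a) //= (bigD1 j) //= !eqxx mulr1 !big1 ?addr0 //.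
  - move=> a' /negPf a'a; rewrite big1 // => j' _.
    by rewrite a'a !mulr0.
  - by move=> j' /negPf j'j; rewrite j'j andbF !mulr0.
move=> D1; have D2 := is_derive_affine (steer_margin i W)
  (y i * (Q *m x i) a ord0 * readout W j ord0) 0.
by rewrite -(@derive_val _ _ _ _ _ _ _ D1) (@derive_val _ _ _ _ _ _ _ D2).
Qed.

Lemma exp_loss_margin : exp_loss x y P = margin_loss steer_margin.
Proof.
by apply/funext => W; apply: eq_bigr => i _; rewrite /steer_margin mulNr.
Qed.

Variables (W : R -> steer_param d0 net -> R) (t0 : R).
Hypothesis flow : gradient_flow (exp_loss x y P) W.
Hypothesis t0_gt0 : 0 < t0.
Hypothesis loss_lt1 : exp_loss x y P (W t0) < 1.

Local Notation F := (margin_loss steer_margin).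

(* The negative gradient with respect to [w_1] is the rank-one matrix [q c^T]
   with [q] this vector and [c] the readout. *)
Definition force (w : steer_param d0 net -> R) : 'cV[R]_d0 :=
  \sum_i (expR (- steer_margin i w) * y i) *: (Q *m x i).

Lemma predictor_invariant w : Q *m P w = #|gT|%:R *: P w.
Proof. by rewrite steer_predictorE// mulmxA reynolds_sqr// -scalemxAl. Qed.

Lemma dot_predictor_force w :
  dot (P w) (force w) = #|gT|%:R * mean_margin steer_margin w.
Proof.
rewrite dot_sumr mulr_sumr; apply: eq_bigr => i _.
rewrite dotZr dot_mulmx reynolds_tr// predictor_invariant dotC dotZr.
by rewrite /steer_margin; ring.
Qed.

(** [Q x_i] sums [rho(g) x_i] over the group, so [u] has margin at least [|G| M] on it. *)
Lemma dot_force_ge (u : 'cV[R]_d0) (M : R) w :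
  (forall i g, M <= y i * dot u (rho g *m x i)) ->
  #|gT|%:R * margin_loss steer_margin w * M <= dot u (force w).
Proof.
move=> uM; rewrite dot_sumr -mulrA mulrCA mulr_suml; apply: ler_sum => i _.
rewrite dotZr -mulrA ler_pM2l ?expR_gt0//.
rewrite /reynolds mulmx_suml dot_sumr mulr_sumr.
apply: le_trans (ler_sum _ (fun g _ => uM i g)).
by rewrite sumr_const mulr_natl.
Qed.

Lemma steer_margin_regular : exists dp (K : R),
  (forall i, curve_gradient (steer_margin i) (dp i)) /\
  (forall i w (r : R), 0 <= r -> (forall c, `|w c| <= r) ->
     steer_margin i w <= K * r ^+ k.+1).
Proof.
have /choice[dp hdp] := steer_margin_gradient.
have /choice[Kf hKf] : forall i, exists Ki, 0 <= Ki /\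
    forall w (r : R), 0 <= r -> (forall c, `|w c| <= r) ->
      `|steer_margin i w| <= Ki * r ^+ k.+1.
  by move=> i; have [Ki ? ?] := steer_margin_growth i; exists Ki.
exists dp, (\sum_i Kf i); split=> // i w r r0 wr.
apply: le_trans (ler_norm _) _; apply: le_trans ((hKf i).2 _ _ r0 wr) _.
rewrite ler_wpM2r ?exprn_ge0// (bigD1 i) //= lerDl.
by apply: sumr_ge0 => i' _; have [] := hKf i'.
Qed.

Let flow' : gradient_flow F W.
Proof. by rewrite -exp_loss_margin. Qed.

Let loss_lt1' : F (W t0) < 1.
Proof. by rewrite -exp_loss_margin. Qed.

Lemma steer_margin_gt0 i t : t0 <= t -> 0 < steer_margin i (W t).
Proof.
have [dp [K [hdp _]]] := steer_margin_regular.
exact: (margin_gt0 hdp flow' t0_gt0 loss_lt1').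
Qed.

(** A single margin is at most a constant times [|P|] by Cauchy-Schwarz, and at least a multiple of
    [|W|^(k+1)] by [margin_growth]. *)
Lemma predictor_growth : exists2 kap, 0 < kap &
  forall t, t0 <= t -> kap * sqnorm (W t) ^+ k.+1 <= dot (P (W t)) (P (W t)).
Proof.
have [dp [K [hdp p_le]]] := steer_margin_regular.
have [a a0 grow] := margin_growth hdp (ltn0Sn k) steer_margin_homog p_le
  flow' t0_gt0 loss_lt1'.
pose X := y ord0 ^+ 2 * dot (x ord0) (x ord0).
have up t : steer_margin ord0 (W t) ^+ 2 <= X * dot (P (W t)) (P (W t)).
  rewrite /steer_margin exprMn /X -mulrA ler_wpM2l ?sqr_ge0//; exact: dot_cauchy_schwarz.
have X0 : 0 < X.
  rewrite lt_neqAle mulr_ge0 ?sqr_ge0 ?dot_ge0// andbT; apply/eqP => X0.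
  have := up t0; rewrite -X0 mul0r leNgt exprn_gt0//.
  exact: steer_margin_gt0.
exists (a ^+ 2 / X) => [|t t0t]; first by rewrite divr_gt0// exprn_gt0.
rewrite mulrAC ler_pdivrMr// [leRHS]mulrC; apply: le_trans (up t).
have -> : a ^+ 2 * sqnorm (W t) ^+ k.+1
    = (a * Num.sqrt (sqnorm (W t)) ^+ k.+1) ^+ 2.
  by rewrite exprMn -exprM mulnC exprM sqr_sqrtr// sqnorm_ge0.
rewrite lerXn2r ?nnegrE ?grow//.
  by rewrite mulr_ge0 ?exprn_ge0 ?sqrtr_ge0// ltW.
by rewrite ltW// steer_margin_gt0.
Qed.

Lemma predictor_unbounded (B : R) : exists2 T, t0 <= T &
  forall t, T <= t -> B <= enorm (P (W t)).
Proof.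
have [dp [K [hdp p_le]]] := steer_margin_regular.
have [a a0 grow] := predictor_growth.
(* The summand [1] gives [s <= s^(k+1)], and [B^2 / a] gives [a s >= B^2]. *)
have [T t0T HT] := sqnorm_unbounded hdp (ltn0Sn k) steer_margin_homog p_le
  flow' t0_gt0 loss_lt1' (1 + B ^+ 2 / a) (lexx t0).
exists T => // t Tt; have := HT t Tt; set s := sqnorm _ => sB.
have s1 : 1 <= s by apply: le_trans (ltW sB); rewrite lerDl divr_ge0// ?sqr_ge0// ltW.
apply: le_trans (ler_norm _) _; rewrite -sqrtr_sqr ler_wsqrtr//.
apply: le_trans (grow t (le_trans t0T Tt)).
apply: (@le_trans _ _ (a * s)); last first.
  by rewrite ler_pM2l// exprS ler_peMr ?(le_trans ler01)// exprn_ege1.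
rewrite mulrC -ler_pdivrMr//; apply: le_trans (ltW sB).
by rewrite lerDr ler01.
Qed.

(* At times where the parameters align with the gradient, so does the predictor
   with the force: [P = Q w_1 c] while [Q (q c^T) c] is a multiple of [q]. *)
Lemma predictor_alignment (eta T : R) : 0 < eta -> t0 <= T ->
  exists2 t, T <= t & exists2 mu, 0 <= mu &
    let v := P (W t) - mu *: force (W t) in
    dot v v <= (eta * enorm (P (W t))) ^+ 2.
Proof.
move=> eta0 t0T.
have [dp [K [hdp p_le]]] := steer_margin_regular.
have [a a0 grow] := predictor_growth.
have /choice[Kr hKr] : forall j, exists Kj : R,
    forall w (r : R), 0 <= r -> (forall c, `|w c| <= r) ->
      `|@readout _ _ d0 _ _ net w j ord0| <= Kj * r ^+ k.
  by move=> j; have [Kj ? ?] := readout_growth j; exists Kj.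
pose CQ := \sum_i \sum_j Q i j ^+ 2.
have CQ0 : 0 <= CQ by apply: sumr_ge0 => i _; apply: sumr_ge0 => j _; exact: sqr_ge0.
pose C1 := \sum_j Kr j ^+ 2.
have C10 : 0 <= C1 by apply: sumr_ge0 => j _; exact: sqr_ge0.
pose C := CQ * C1 / a.
have C0 : 0 <= C by rewrite divr_ge0 ?mulr_ge0// ltW.
(* [C] bounds [|Q|^2 |c|^2 |W|^2] by a multiple of [|P|^2], with the Frobenius norm of [Q]; adding
   [1] covers [C = 0]. *)
have eps0 : 0 < eta ^+ 2 / (C + 1) by rewrite divr_gt0 ?exprn_gt0// ltr_wpDl.
have [t Tt [l l0 align]] := flow_alignment hdp (ltn0Sn k) steer_margin_homog p_le
  flow' t0_gt0 loss_lt1' eps0 t0T.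
set eps := eta ^+ 2 / _ in eps0 align.
exists t => //; pose c := readout (W t); pose q := force (W t).
have cc0 : 0 <= dot c c by exact: dot_ge0.
exists (l * dot c c * #|gT|%:R); first by rewrite !mulr_ge0.
have S0 := sqnorm_ge0 (W t).
(* The [w_1]-block of [W - l g], hence no larger than the whole residual. *)
pose E := first_layer (W t) - l *: (q *m c^T).
have -> /= : P (W t) - (l * dot c c * #|gT|%:R) *: q = Q *m (E *m c).
  have Qq : Q *m q = #|gT|%:R *: q.
    rewrite /q /force mulmx_sumr scaler_sumr; apply: eq_bigr => i _.
    by rewrite -scalemxAr mulmxA reynolds_sqr// -scalemxAl !scalerA [in RHS]mulrC.
  have ccE : c^T *m c = (dot c c)%:M.
    by rewrite [LHS]mx11_scalar dotE.
  rewrite mulmxBl mulmxBr -steer_predictorE//; congr (_ - _).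
  rewrite -scalemxAl -mulmxA ccE mul_mx_scalar -!scalemxAr Qq !scalerA.
  by congr (_ *: _); ring.
have E_le : \sum_i \sum_j E i j ^+ 2 <= eps * sqnorm (W t).
  apply: le_trans align; rewrite big_sumType /= -[leLHS]addr0 lerD//; last first.
    by apply: sumr_ge0 => ? _; exact: sqr_ge0.
  rewrite pair_big /= le_eqVlt; apply/orP; left; apply/eqP.
  apply: eq_bigr => -[i j] _ /=; congr (_ ^+ 2).
  rewrite !mxE big_ord1 !mxE; congr (_ - l * _).
  rewrite /descent /q /force summxE mulr_suml; apply: eq_bigr => i' _.
  rewrite (steer_margin_partial _ _ _ (hdp i')) !mxE; ring.
have c_le : dot c c <= C1 * sqnorm (W t) ^+ k.
  rewrite /C1 mulr_suml; apply: ler_sum => j _; rewrite -expr2.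
  have -> : Kr j ^+ 2 * sqnorm (W t) ^+ k
      = (Kr j * Num.sqrt (sqnorm (W t)) ^+ k) ^+ 2.
    by rewrite exprMn -exprM mulnC exprM sqr_sqrtr.
  rewrite -[leLHS]real_normK ?num_real//.
  have cj := hKr j _ _ (sqrtr_ge0 _) (coord_le_norm (W t)).
  by rewrite lerXn2r ?nnegrE// (le_trans _ cj).
apply: le_trans (dot_mulmx_le _ _) _; rewrite -/CQ.
apply: (@le_trans _ _ (CQ * (eps * sqnorm (W t) * (C1 * sqnorm (W t) ^+ k)))).
  rewrite ler_wpM2l//; apply: le_trans (dot_mulmx_le _ _) _.
  rewrite ler_pM//.
  by apply: sumr_ge0 => i _; apply: sumr_ge0 => j _; exact: sqr_ge0.
rewrite exprMn enorm_sqr.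
have -> : CQ * (eps * sqnorm (W t) * (C1 * sqnorm (W t) ^+ k))
    = eps * C * (a * sqnorm (W t) ^+ k.+1).
  by rewrite /C exprS; field; rewrite gt_eqF.
have epsC : eps * C <= eta ^+ 2.
  rewrite /eps mulrAC ler_pdivrMr ?ltr_wpDl// ler_pM2l ?exprn_gt0//.
  by rewrite lerDl.
apply: ler_pM => //.
- by rewrite mulr_ge0// ltW.
- by rewrite mulr_ge0 ?exprn_ge0// ltW.
- exact: grow (le_trans t0T Tt).
Qed.

Lemma steer_margin_optimal (b u : 'cV[R]_d0) (M : R) :
  directional_limit (fun t => P (W t)) b -> dot u u <= 1 ->
  (forall i g, M <= y i * dot u (rho g *m x i)) ->
  forall j h, M <= y j * dot b (rho h *m x j).
Proof.
move=> blim u1 uM j h; set a := y j * _.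
have abs_le (s r : R) : s ^+ 2 <= r ^+ 2 -> 0 <= r -> `|s| <= r.
  by move=> sr r0; rewrite -ler_sqr ?nnegrE// real_normK ?num_real.
(* By invariance of [P], the normalised margin on [rho h *m x j] is the one on [x j]. *)
have lim_a : steer_margin j (W t) / enorm (P (W t)) @[t --> +oo] --> a.
  have -> : (fun t => steer_margin j (W t) / enorm (P (W t)))
      = (fun t => y j * dot ((enorm (P (W t)))^-1 *: P (W t)) (rho h *m x j)).
    apply/funext => t; rewrite [dot (_ *: _) _]dotC dotZr [dot (rho h *m _) _]dotC.
    rewrite {3}steer_predictorE// dot_reynolds_rho// -steer_predictorE//.
    by rewrite /steer_margin dotC; ring.
  by apply: cvgM; [exact: cvg_cst|apply: dot_cvg; [exact: blim|exact: cvg_cst]].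
have a_ge0 : 0 <= a.
  apply: (cvgr_to_ge lim_a); near=> t; rewrite divr_ge0 ?sqrtr_ge0// ltW//.
  by apply: steer_margin_gt0; near: t; apply: nbhs_pinfty_ge; exact: num_real.
rewrite leNgt; apply/negP => aM.
(* For [eta <= 1] and [a < M], the final inequality [M (1 - eta) <= (1 + eta) (a + 2 eta)] implies
   [M - a <= eta (4 + 2 M)], whose right side is here half of [M - a]. *)
pose eta := (M - a) / (2 * (4 + 2 * M)).
have M0 : 0 < M by exact: le_lt_trans aM.
have den0 : 0 < 2 * (4 + 2 * M) by lra.
have eta0 : 0 < eta by rewrite divr_gt0// subr_gt0.
have etaE : eta * (2 * (4 + 2 * M)) = M - a by rewrite divfK// gt_eqF.
have [T1 [_ HT1]] : \forall t \near +oo, steer_margin j (W t) / enorm (P (W t)) <= a + eta.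
  by apply: (cvgr_le _ lim_a); rewrite ltrDl.
(* Makes [n + 1] at most [eta |P|], which absorbs the additive constant of [mean_margin_le]. *)
have [T2 t0T2 HT2] := predictor_unbounded (n.+1%:R / eta).
(* [HT1] applies strictly after [T1], hence the [+ 1]. *)
pose T := Num.max T2 (T1 + 1).
have t0T : t0 <= T by rewrite le_max t0T2.
have [t Tt [mu mu0 /=]] := predictor_alignment eta0 t0T.
have T2t : T2 <= t by apply: le_trans Tt; rewrite le_max lexx.
have T1t : T1 < t by apply: lt_le_trans Tt; rewrite lt_max ltrDl ltr01 orbT.
have t0t := le_trans t0T Tt.
set p := P (W t); set q := force (W t); set v := p - mu *: q => vv.
have r0 : 0 < enorm p by apply: lt_le_trans (HT2 _ T2t); rewrite divr_gt0.
have := HT1 t T1t; rewrite ler_pdivrMr// => pj_le.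
have := HT2 t T2t; rewrite ler_pdivrMr// => N_le.
rewrite -/p in pj_le N_le; set r := enorm p in r0 pj_le N_le vv.
have etar0 : 0 <= eta * r by rewrite mulr_ge0// ltW.
have rr : dot p p = r ^+ 2 by rewrite enorm_sqr.
have pv : dot p v <= eta * r * r.
  apply: le_trans (ler_norm _) _; apply: abs_le; last by rewrite mulr_ge0// ltW.
  apply: le_trans (dot_cauchy_schwarz _ _) _.
  by rewrite rr exprMn mulrC ler_wpM2r// sqr_ge0.
have uv : - dot u v <= eta * r.
  apply: le_trans (ler_norm _) _; rewrite normrN; apply: abs_le => //.
  apply: le_trans (dot_cauchy_schwarz _ _) _.
  by rewrite -[leRHS]mul1r ler_pM ?dot_ge0.
have up : dot u p <= r.
  apply: le_trans (ler_norm _) _; apply: abs_le; last exact: ltW.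
  apply: le_trans (dot_cauchy_schwarz _ _) _.
  by rewrite rr -[leRHS]mul1r ler_wpM2r// sqr_ge0.
pose f := margin_loss steer_margin (W t).
(* Pairing [mu q] with [u] bounds [kp M] above, and pairing it with [P] bounds [kp (p_j + n + 1)]
   below; combining the two eliminates [kp]. *)
pose kp := mu * #|gT|%:R * f.
have kp0 : 0 <= kp by rewrite !mulr_ge0// ltW// margin_loss_gt0.
have kpM : kp * M <= (1 + eta) * r.
  have := dot_force_ge (W t) uM; rewrite -/q -/f => /(ler_wpM2l mu0).
  move: uv; rewrite dotBr dotZr /kp; lra.
have kp_ge : (1 - eta) * r ^+ 2 <= kp * (steer_margin j (W t) + n.+1%:R).
  move: pv; rewrite dotBr dotZr rr dot_predictor_force.
  have /(ler_wpM2l (mulr_ge0 mu0 (ler0n R #|gT|))) :=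
    mean_margin_le steer_margin j (W t).
  rewrite -/f /kp; lra.
have : M * (1 - eta) * r ^+ 2 <= (1 + eta) * (a + 2 * eta) * r ^+ 2.
  have s_le : steer_margin j (W t) + n.+1%:R <= (a + 2 * eta) * r by lra.
  apply: (@le_trans _ _ (M * (kp * ((a + 2 * eta) * r)))).
    rewrite -mulrA ler_pM2l//; apply: le_trans kp_ge _.
    by rewrite ler_wpM2l.
  rewrite mulrA [M * kp]mulrC.
  apply: le_trans (ler_wpM2r _ kpM) _; last by rewrite le_eqVlt; apply/orP; left; apply/eqP; ring.
  by apply: mulr_ge0; [lra|exact: ltW].
rewrite ler_pM2r ?exprn_gt0//.
have eta1 : eta <= 1 by rewrite ler_pdivrMr//; lra.
nra.
Unshelve. all: by end_near.
Qed.

End SteerableMargin.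

(** * Comparison with the fully-connected limit *)

Theorem theorem6p1 (R : realType) (gT : finGroupType) (d0 : nat)
  (rho0 : mx_representation R [set: gT]%G d0)
  (rho0_unitary : forall g : gT, rho0 (g^-1)%g = (rho0 g)^T)
  (n : nat) (x : 'I_n.+1 -> 'cV[R]_d0) (y : 'I_n.+1 -> R)
  (y_sign : forall i : 'I_n.+1, y i = 1 \/ y i = -1)
  (L : nat) (L_ge2 : (2 <= L)%N)
  (d1 : nat) (net : steerable_layers (regular_rep R gT d1) L.-1)
  (W : R -> steer_param d0 net -> R)
  (W_flow : gradient_flow (exp_loss x y (steer_predictor rho0 net)) W)
  (t0 : R) (t0_gt0 : 0 < t0)
  (W_loss : exp_loss x y (steer_predictor rho0 net) (W t0) < 1)
  (beta_steer : 'cV[R]_d0)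
  (beta_steer_lim :
    directional_limit (fun t : R => steer_predictor rho0 net (W t)) beta_steer)
  (ks : seq nat) (ks_size : size ks = L.-1)
  (ks_gt0 : forall k : nat, k \in ks -> (0 < k)%N)
  (Wfc : R -> fc_param d0 ks -> R)
  (Wfc_flow : gradient_flow (exp_loss x y (fc_predictor d0 ks)) Wfc)
  (t0' : R) (t0'_gt0 : 0 < t0')
  (Wfc_loss : exp_loss x y (fc_predictor d0 ks) (Wfc t0') < 1)
  (beta_fc : 'cV[R]_d0)
  (beta_fc_lim :
    directional_limit (fun t : R => fc_predictor d0 ks (Wfc t)) beta_fc) :
  augmented_margin rho0 x y beta_steer >= augmented_margin rho0 x y beta_fc.
Proof.
have fc_le1 : dot beta_fc beta_fc <= 1.
  pose f t := fc_predictor d0 ks (Wfc t).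
  have lim_fc : dot ((enorm (f t))^-1 *: f t) ((enorm (f t))^-1 *: f t) @[t --> +oo]
      --> dot beta_fc beta_fc by apply: dot_cvg; exact: beta_fc_lim.
  apply: (cvgr_to_le lim_fc); near=> t; set b := f t.
  rewrite dotZr dotC dotZr -enorm_sqr.
  (* Where the predictor vanishes, its normalisation has norm [0] and not [1]. *)
  have [-> | b0] := eqVneq (enorm b) 0; first by rewrite expr0n !mulr0 ler01.
  by rewrite expr2 mulKf// mulVf.
have fc_le i g : augmented_margin rho0 x y beta_fc
    <= y i * dot beta_fc (rho0 g *m x i).
  exact: (bigmin_le _ (i, g)).
have opt := steer_margin_optimal rho0_unitary W_flow t0_gt0 W_loss beta_steer_lim
  fc_le1 fc_le.
by apply: le_bigmin => [|[i g] _]; apply: opt.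
Unshelve. all: by end_near.
Qed.
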